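(* Assume that monoid presentations $\langle X\mid R\rangle$ and $\langle Y\mid T\rangle$ of the monoids $U$ and $A$, respectively, are given with $X\cap Y=\emptyset$, and that functions $Y\times X\to Y^*$, written $(\alpha,u)\mapsto\alpha^u$, and $Y\times X\to X$, written $(\alpha,u)\mapsto\alpha\cdot u$, are given. Let $\sim_R$ and $\sim_T$ denote the equivalence relations on $X^*$ and $Y^*$ imposed by the relation sets $R$ and $T$, respectively (that is, the congruences they generate). Let the functions be extended to functions $Y^*\times X^*\to Y^*$ and $Y^*\times X^*\to X^*$ as described in the context, and assume that they satisfy the following: - if $(u,v)\in R$, then for all $\alpha\in Y$ we have that $(\alpha\cdot u,\alpha\cdot v)$ or $(\alpha\cdot v,\alpha\cdot u)$ is in $R$, and $\alpha^u\sim_T\alpha^v$; - if $(\alpha,\beta)\in T$, then for all $u\in X$ we have $\alpha\cdot u=\beta\cdot u$ and $\alpha^u\sim_T\beta^u$. Then the extensions induce well defined functions $A\times U\to A$, $(\alpha,u)\mapsto\alpha^u$, and $A\times U\to U$, $(\alpha,u)\mapsto\alpha\cdot u$, with all of the following properties. (1) They are defined on all of $A\times U$ and, for all $\alpha,\beta\in A$ and $u,v\in U$, $$(\alpha\beta)\cdot u=\alpha\cdot(\beta\cdot u),\quad (\alpha\beta)^u=\alpha^{\beta\cdot u}\beta^u,\quad \alpha\cdot(uv)=(\alpha\cdot u)(\alpha^u\cdot v),\quad \alpha^{uv}=(\alpha^u)^v,$$ $$\alpha^{1}=\alpha,\quad 1\cdot u=u,\quad \alpha\cdot 1=1,\quad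 1^u=1.$$ (2) The function $(\alpha,u)\mapsto\alpha\cdot u$ takes $Y\times X$ into $X$, and the function $(\alpha,u)\mapsto\alpha^u$ takes $Y\times X$ into $Y$. (3) Thus a presentation for the structure defined on $U\times A$ by the multiplication $(u,\alpha)(v,\beta)=(u(\alpha\cdot v),\ \alpha^v\beta)$ is $$\langle X\cup Y\mid R\cup T\cup W\rangle$$ in which $W$ consists of all pairs $(\alpha u,\ (\alpha\cdot u)(\alpha^u))$ for $(\alpha,u)\in Y\times X$. Further, the restriction of the function $A\times U\to U$ to $A\times X$ has its image in $X$.
   Context: For a set $Z$, $Z^*$ is the free monoid of finite words in $Z$ (including the empty word). A monoid presentation $\langle Z\mid P\rangle$, with $P$ a binary relation on $Z^*$, presents the quotient of $Z^*$ by the congruence generated by $P$. In statements about the induced functions on $A\times U$, elements of $X$ and $Y$ stand for the elements of $U$ and $A$ that they represent, and $1$ denotes the identity of $U$ or of $A$. Extension of the functions: let $W$ be the set of rewriting rules $\alpha u\rightarrow(\alpha\cdot u)(\alpha^u)$ on $(X\cup Y)^*$ for $(\alpha,u)\in Y\times X$. The monoid presentation $\langle X\cup Y\mid W\rangle$ is complete (its rewriting relation is terminating and confluent), and its irreducible words are those of the form $p\xi$ with $p\in X^*$ and $\xi\in Y^*$. For $\alpha\in Y^*$ and $u\in X^*$, the elements $\alpha\cdot u\in X^*$ and $\alpha^u\in Y^*$ are the unique words such that $\alpha u$ is equivalent to $(\alpha\cdot u)(\alpha^u)$ under the congruence generated by $W$. This extends the given functions on $Y\times X$.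
   Formalization: In (2), the claim that α^u maps Y×X into Y fails for values in Y^* (X={x}, Y={y}, R=T=∅, y·x=x, y^x=yy); it is replaced by: α^u is the element of A represented by the given word, and it lies in Y whenever all the given words α^u are single letters of Y. *)

(* Defs.v *)
From HB Require Import structures.
From mathcomp Require Import all_boot.
From mathcomp Require Import boolp classical_sets.

Set Implicit Arguments.
Unset Strict Implicit.
Unset Printing Implicit Defensive.

Local Open Scope classical_set_scope.
Local Open Scope group_scope.
Local Open Scope quotient_scope.

(* The free monoid Z^* is [seq Z], with concatenation and the empty word;
   a binary relation on Z^* is a set of pairs of words. *)
Definition wrel (Z : Type) := set (seq Z * seq Z).

Inductive congr_gen (Z : Type) (P : wrel Z) : seq Z -> seq Z -> Prop :=
| congr_rule u v : P (u, v) -> congr_gen P u v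
| congr_refl u : congr_gen P u u
| congr_sym u v : congr_gen P u v -> congr_gen P v u
| congr_trans u v w : congr_gen P u v -> congr_gen P v w -> congr_gen P u w
| congr_cat u u' v v' : congr_gen P u u' -> congr_gen P v v' ->
    congr_gen P (u ++ v) (u' ++ v').

Section PresentedMonoid.
Variables (Z : choiceType) (P : wrel Z).

Definition congrb : rel (seq Z) := fun u v => `[< congr_gen P u v >].

Lemma congrb_refl : reflexive congrb.
Proof. by move=> u; apply/asboolP; exact: congr_refl. Qed.

Lemma congrb_sym : symmetric congrb.
Proof. by move=> u v; apply/asboolP/asboolP; exact: congr_sym. Qed.

Lemma congrb_trans : transitive congrb.
Proof.
move=> v u w /asboolP uv /asboolP vw; apply/asboolP.
exact: congr_trans uv vw.
Qed.

Canonical congrb_equiv :=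
  EquivRel congrb congrb_refl congrb_sym congrb_trans.

Definition pres_monoid : Type := {eq_quot congrb}.
HB.instance Definition _ := Choice.on pres_monoid.

Definition wclass (w : seq Z) : pres_monoid := \pi_{eq_quot congrb} w.

Lemma wclassP u v : wclass u = wclass v <-> congr_gen P u v.
Proof.
split=> [/eqmodP/asboolP // | uv].
by apply/eqmodP/asboolP.
Qed.

Definition pres_mul (x y : pres_monoid) : pres_monoid :=
  wclass (repr x ++ repr y).

Lemma wclass_repr x : wclass (repr x) = x.
Proof. exact: reprK. Qed.

Lemma pres_mulE u v : pres_mul (wclass u) (wclass v) = wclass (u ++ v).
Proof. by apply/wclassP/congr_cat; apply/wclassP; rewrite wclass_repr. Qed.

Lemma pres_mulA : associative pres_mul.
Proof.
move=> x y z; rewrite -(wclass_repr x) -(wclass_repr y) -(wclass_repr z).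
by rewrite !pres_mulE catA.
Qed.

Lemma pres_mul1 : left_id (wclass [::]) pres_mul.
Proof. by move=> x; rewrite -(wclass_repr x) pres_mulE. Qed.

Lemma pres_mulr1 : right_id (wclass [::]) pres_mul.
Proof. by move=> x; rewrite -(wclass_repr x) pres_mulE cats0. Qed.

HB.instance Definition _ :=
  isMonoid.Build pres_monoid pres_mulA pres_mul1 pres_mulr1.

End PresentedMonoid.

(* <Z | P> is a presentation of the monoid M in which the generator z stands
   for the element [g z] of M. *)
Definition presents (Z : choiceType) (P : wrel Z) (M : monoidType)
    (g : Z -> M) : Prop :=
  exists f : UMagmaMorphism.type (pres_monoid P) M,
    bijective f /\ forall z, f (wclass P [:: z]) = g z.

Definition weval (Z : Type) (M : monoidType) (g : Z -> M) (w : seq Z) : M :=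
  \prod_(z <- w) g z.

Definition map_wrel (Z Z' : Type) (f : Z -> Z') (P : wrel Z) : wrel Z' :=
  (fun p => (map f p.1, map f p.2)) @` P.

(* The disjoint union of X and Y is the sum type X + Y. *)
Section Crossing.
Variables (X Y : choiceType) (dot : Y -> X -> X) (pow : Y -> X -> seq Y).

Definition crossing_rules : wrel (X + Y) :=
  [set p | exists a u,
     p = ([:: inr a; inl u], inl (dot a u) :: map inr (pow a u))].

(* The pair (a . u, a ^ u), selected as the unique pair of words in
   X^* x Y^* for which a u is equivalent to (a . u)(a ^ u); the default value
   ([::], [::]) of [xget] is never used. *)
Definition crossing (a : seq Y) (u : seq X) : seq X * seq Y :=
  xget ([::], [::])
    [set p : seq X * seq Y |
      congr_gen crossing_rules
        (map inr a ++ map inl u) (map inl p.1 ++ map inr p.2)].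

Definition wdot (a : seq Y) (u : seq X) : seq X := (crossing a u).1.
Definition wpow (a : seq Y) (u : seq X) : seq Y := (crossing a u).2.

End Crossing.

Section ZappaSzep.
Variables (U A : monoidType) (act : A -> U -> U) (expo : A -> U -> A).

Record zappa_szep : Prop := ZappaSzep {
  zs_actM : forall a b u, act (a * b) u = act a (act b u);
  zs_expoMl : forall a b u, expo (a * b) u = expo a (act b u) * expo b u;
  zs_actMr : forall a u v, act a (u * v) = act a u * act (expo a u) v;
  zs_expoM : forall a u v, expo a (u * v) = expo (expo a u) v;
  zs_expo1 : forall a, expo a 1 = a;
  zs_act1 : forall u, act 1 u = u;
  zs_act1r : forall a, act a 1 = 1;
  zs_expo1l : forall u, expo 1 u = 1
}.

Definition zs_product (_ : zappa_szep) : Type := (U * A)%type.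

Variable zs : zappa_szep.

HB.instance Definition _ := Choice.copy (zs_product zs) (U * A)%type.

Definition zs_mul (p q : zs_product zs) : zs_product zs :=
  (p.1 * act p.2 q.1, expo p.2 q.1 * q.2).

Definition zs_one : zs_product zs := (1, 1).

Lemma zs_mulA : associative zs_mul.
Proof.
move=> [u a] [v b] [w c]; rewrite /zs_mul /=; congr pair.
  by rewrite (zs_actMr zs) (zs_actM zs) !mulgA.
by rewrite (zs_expoMl zs) (zs_expoM zs) !mulgA.
Qed.

Lemma zs_mul1 : left_id zs_one zs_mul.
Proof.
by move=> [u a]; rewrite /zs_mul /= (zs_act1 zs) (zs_expo1l zs) !mul1g.
Qed.

Lemma zs_mulr1 : right_id zs_one zs_mul.
Proof.
by move=> [u a]; rewrite /zs_mul /= (zs_act1r zs) (zs_expo1 zs) !mulg1.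
Qed.

HB.instance Definition _ :=
  isMonoid.Build (zs_product zs) zs_mulA zs_mul1 zs_mulr1.

Definition zs_gen (X Y : Type) (i : X -> U) (j : Y -> A) (z : X + Y) :
    zs_product zs :=
  match z with inl x => (i x, 1) | inr y => (1, j y) end.

End ZappaSzep.

(* Main.v *)
Require Import Defs.
From HB Require Import structures.
From mathcomp Require Import all_boot.
From mathcomp Require Import boolp classical_sets.

(** The rules [W] make sense of two functions on pairs of words by recursion
    on letters, and these functions satisfy the Zappa-Szep laws between the
    free monoids.  Evaluating a word on [X + Y] in the resulting product of
    free monoids is invariant under [W] and sends [p xi] to [(p, xi)]; hence
    the normal form of a word is unique and the recursive functions are the
    crossing functions.  The hypotheses on [R] and [T] propagate from letters
    to words, so that the laws descend to [U] and [A].  Evaluation in the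
    product of [U] and [A] then respects [R], [T] and [W], is onto, and
    separates normal forms up to [R] and [T], which gives the presentation. *)

Set Implicit Arguments.
Unset Strict Implicit.
Unset Printing Implicit Defensive.

Local Open Scope classical_set_scope.

(** * Congruences generated by relations on words *)

Section CongruenceClosure.
Variables (Z Z' : Type) (P : wrel Z) (P' : wrel Z').

Lemma congr_gen_map (f : Z -> Z') :
  (forall u v, P (u, v) -> congr_gen P' (map f u) (map f v)) ->
  forall u v, congr_gen P u v -> congr_gen P' (map f u) (map f v).
Proof.
move=> fP u v; elim=> {u v}.
- exact: fP.
- by move=> u; exact: congr_refl.
- by move=> u v _ uv; exact: congr_sym.
- by move=> u v w _ uv _; exact: congr_trans.
- by move=> u u' v v' _ uu' _ vv'; rewrite !map_cat; exact: congr_cat.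
Qed.

Lemma congr_cons z u v : congr_gen P u v -> congr_gen P (z :: u) (z :: v).
Proof. exact: (@congr_cat _ _ [:: z] [:: z]) (congr_refl _ _). Qed.

End CongruenceClosure.

Lemma congr_gen_sub (Z : Type) (P P' : wrel Z) u v :
  P `<=` P' -> congr_gen P u v -> congr_gen P' u v.
Proof.
move=> PP' uv; rewrite -(map_id u) -(map_id v).
apply: congr_gen_map uv => {}u {}v Puv; rewrite !map_id.
by apply: congr_rule; exact: PP'.
Qed.

(** * Evaluation of words and presentations *)

Section Evaluation.
Variables (Z : Type) (M : monoidType) (g : Z -> M).

Lemma weval_nil : weval g [::] = 1%g.
Proof. by rewrite /weval big_nil. Qed.

Lemma weval_cat u v : weval g (u ++ v) = (weval g u * weval g v)%g.
Proof. by rewrite /weval big_cat. Qed.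

Lemma weval_cons z w : weval g (z :: w) = (g z * weval g w)%g.
Proof. by rewrite /weval big_cons. Qed.

Lemma weval1 z : weval g [:: z] = g z.
Proof. by rewrite weval_cons weval_nil mulg1. Qed.

Lemma weval_congr (P : wrel Z) :
  (forall u v, P (u, v) -> weval g u = weval g v) ->
  forall u v, congr_gen P u v -> weval g u = weval g v.
Proof.
move=> gP u v; elim=> {u v} //.
- by move=> u v w _ -> _ ->.
- by move=> u u' v v' _ uu' _ vv'; rewrite !weval_cat uu' vv'.
Qed.

End Evaluation.

(** A morphism fixed on letters is evaluation on classes, so it is bijective exactly when evaluation
    is onto with kernel the generated congruence. This form lets later proofs work with words
    only. *)
Lemma presentsP (Z : choiceType) (P : wrel Z) (M : monoidType) (g : Z -> M) :
  presents P g <->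
  (forall x, exists w, weval g w = x) /\
  (forall u v, congr_gen P u v <-> weval g u = weval g v).
Proof.
split=> [[f [bf fg]] | [gsurj gP]].
  have fE w : weval g w = f (wclass P w).
    elim: w => [|z w IHw]; first by rewrite weval_nil -(@gmulf1 _ _ f).
    rewrite weval_cons IHw -fg -gmulfM; congr (f _).
    by rewrite /mul /= pres_mulE.
  split=> [x|u v].
    by case: bf => h _ hK; exists (repr (h x)); rewrite fE wclass_repr hK.
  rewrite !fE -wclassP; split=> [->//|]; exact: bij_inj bf _ _.
pose f (x : pres_monoid P) : M := weval g (repr x).
have fE w : f (wclass P w) = weval g w.
  by apply/gP/wclassP; rewrite wclass_repr.
have f1 : f 1%g = 1%g by rewrite -[1%g]/(wclass P [::]) fE weval_nil.
have fM : {morph f : x y / (x * y)%g >-> (x * y)%g}.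
  by move=> x y; rewrite -[(x * y)%g]/(pres_mul x y) fE weval_cat.
pose fH := Multiplicative_isUMagmaMorphism.Build (pres_monoid P) M f f1.
pose fH' := isMultiplicative.Build (pres_monoid P) M f fM.
pose F : UMagmaMorphism.type (pres_monoid P) M := HB.pack f fH fH'.
exists F; split; last by move=> z; rewrite -[LHS]/(f _) fE weval1.
have [s sK] := choice gsurj.
(* The inverse sends [x] to the class of a chosen word with value [x]. *)
exists (fun x => wclass P (s x)) => x /=.
  by rewrite -[RHS]wclass_repr; apply/wclassP/gP; rewrite sK.
by rewrite -[LHS]/(f _) fE sK.
Qed.

(** * Evaluation in a Zappa-Szep product *)

Section ZappaSzepEvaluation.
Variables (U A : monoidType) (act : A -> U -> U) (expo : A -> U -> A).
Variable zs : zappa_szep act expo.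

Lemma zs_mulE (p q : zs_product zs) :
  (p * q)%g = ((p.1 * act p.2 q.1)%g, (expo p.2 q.1 * q.2)%g) :> zs_product zs.
Proof. by []. Qed.

Variables (X Y : Type) (i : X -> U) (j : Y -> A).

(** With all letters of [X] first, only units ever cross, and the unit laws make those crossings
    trivial. *)
Lemma weval_zs_gen u a :
  weval (zs_gen zs i j) (map inl u ++ map inr a) = (weval i u, weval j a).
Proof.
elim: u => [|x u IHu] /=; last first.
  by rewrite weval_cons IHu zs_mulE /= (zs_act1 zs) (zs_expo1l zs) mul1g
     weval_cons.
elim: a => [|y a IHa] /=; first by rewrite !weval_nil.
by rewrite weval_cons IHa zs_mulE /= !weval_nil (zs_act1r zs) (zs_expo1 zs)
   mul1g weval_cons.
Qed.

Lemma weval_zs_genl u : weval (zs_gen zs i j) (map inl u) = (weval i u, 1%g).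
Proof. by rewrite -[map inl u]cats0 (weval_zs_gen u [::]) weval_nil. Qed.

Lemma weval_zs_genr a : weval (zs_gen zs i j) (map inr a) = (1%g, weval j a).
Proof. by rewrite (weval_zs_gen [::] a) weval_nil. Qed.

Lemma weval_zs_gen_swap y x :
  weval (zs_gen zs i j) [:: inr y; inl x] =
  (act (j y) (i x), expo (j y) (i x)).
Proof. by rewrite weval_cons weval1 zs_mulE /= mul1g mulg1. Qed.

End ZappaSzepEvaluation.

Definition free_monoid (Z : choiceType) : Type := seq Z.
HB.instance Definition _ (Z : choiceType) := Choice.on (free_monoid Z).
HB.instance Definition _ (Z : choiceType) :=
  isMonoid.Build (free_monoid Z) (@catA Z) (@cat0s Z) (@cats0 Z).

Lemma weval_free (Z : choiceType) (w : seq Z) :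
  weval (fun z => [:: z] : free_monoid Z) w = w.
Proof. by elim: w => [|z w IHw]; rewrite (weval_nil, weval_cons) ?IHw. Qed.

(** * Crossing of words by recursion on letters *)

Section CrossingWords.
Variables (X Y : choiceType) (dot : Y -> X -> X) (pow : Y -> X -> seq Y).

(** The letter [x] crosses [a] from right to left, so [y] meets [foldr dot x a']. This stays a
    single letter because [dot] takes values in [X]. *)
Fixpoint lpow (a : seq Y) (x : X) : seq Y :=
  if a is y :: a' then pow y (foldr dot x a') ++ lpow a' x else [::].

Fixpoint rdot (a : seq Y) (u : seq X) : seq X :=
  if u is x :: u' then foldr dot x a :: rdot (lpow a x) u' else [::].

Fixpoint rpow (a : seq Y) (u : seq X) : seq Y :=
  if u is x :: u' then rpow (lpow a x) u' else a.

Lemma lpow_cat a b x : lpow (a ++ b) x = lpow a (foldr dot x b) ++ lpow b x.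
Proof. by elim: a => //= y a ->; rewrite foldr_cat catA. Qed.

Lemma rdot_catl a b u : rdot (a ++ b) u = rdot a (rdot b u).
Proof. by elim: u a b => //= x u IHu a b; rewrite foldr_cat lpow_cat IHu. Qed.

Lemma rpow_catl a b u : rpow (a ++ b) u = rpow a (rdot b u) ++ rpow b u.
Proof. by elim: u a b => //= x u IHu a b; rewrite lpow_cat IHu. Qed.

Lemma rdot_catr a u v : rdot a (u ++ v) = rdot a u ++ rdot (rpow a u) v.
Proof. by elim: u a => //= x u IHu a; rewrite IHu. Qed.

Lemma rpow_catr a u v : rpow a (u ++ v) = rpow (rpow a u) v.
Proof. by elim: u a => //= x u IHu a; rewrite IHu. Qed.

Lemma rdot_nil u : rdot [::] u = u.
Proof. by elim: u => //= x u ->. Qed.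

Lemma rpow_nil u : rpow [::] u = [::].
Proof. by elim: u. Qed.

(** The resulting product of free monoids is the model in which normal forms are told apart. *)
Lemma crossing_zappa_szep :
  zappa_szep (rdot : free_monoid Y -> free_monoid X -> free_monoid X)
             (rpow : free_monoid Y -> free_monoid X -> free_monoid Y).
Proof.
split=> //.
- exact: rdot_catl.
- exact: rpow_catl.
- exact: rdot_catr.
- exact: rpow_catr.
- exact: rdot_nil.
- exact: rpow_nil.
Qed.

Local Notation W := (crossing_rules dot pow).

(** One letter crosses a word by one rule per letter of that word; then the letters of [u] cross in
    turn, leftmost first. *)
Lemma crossing_congr a u :
  congr_gen W (map inr a ++ map inl u)
    (map inl (rdot a u) ++ map inr (rpow a u)).
Proof.
have letter b x : congr_gen W (map inr b ++ [:: inl x])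
    (inl (foldr dot x b) :: map inr (lpow b x)).
  elim: b => [|y b IHb] /=; first exact: congr_refl.
  apply: congr_trans (congr_cons (inr y) IHb) _.
  rewrite map_cat -cat_cons -(cat1s (inr y)) -(cat1s (inl _)) catA.
  apply: congr_cat; last exact: congr_refl.
  by apply: congr_rule; exists y, (foldr dot x b).
elim: u a => [|x u IHu] a /=; first by rewrite cats0; exact: congr_refl.
rewrite -(cat1s (inl x)) catA.
apply: congr_trans (congr_cat (letter a x) (congr_refl _ _)) _.
by apply: congr_cons; exact: IHu.
Qed.

Lemma crossing_normal_form_unique p q p' q' :
  congr_gen W (map inl p ++ map inr q) (map inl p' ++ map inr q') ->
  (p, q) = (p', q').
Proof.
pose i x : free_monoid X := [:: x]; pose j y : free_monoid Y := [:: y].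
pose g := zs_gen crossing_zappa_szep i j.
have gW u v : W (u, v) -> weval g u = weval g v.
  case=> y [x [-> ->]]; rewrite weval_zs_gen_swap /=.
  by rewrite (weval_zs_gen _ i j [:: dot y x]) weval1 weval_free cats0.
by move/(weval_congr gW); rewrite !weval_zs_gen !weval_free.
Qed.

Lemma crossingE a u : crossing dot pow a u = (rdot a u, rpow a u).
Proof.
rewrite /crossing; case: xgetP => [[p q] _ /= pqP | noP]; last first.
  (* The default of [xget] is excluded: the recursive pair lies in the set. *)
  by case: (noP (rdot a u, rpow a u)); exact: crossing_congr.
apply: crossing_normal_form_unique.
exact: congr_trans (congr_sym pqP) (crossing_congr a u).
Qed.

Lemma wdotE a u : wdot dot pow a u = rdot a u.
Proof. by rewrite /wdot crossingE. Qed.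

Lemma wpowE a u : wpow dot pow a u = rpow a u.
Proof. by rewrite /wpow crossingE. Qed.

Lemma congr_gen_normal_form w :
  exists p q, congr_gen W w (map inl p ++ map inr q).
Proof.
elim: w => [|[x|y] w [p [q IHw]]].
- by exists [::], [::]; exact: congr_refl.
- by exists (x :: p), q; exact: congr_cons.
- exists (rdot [:: y] p), (rpow [:: y] p ++ q).
  apply: congr_trans (congr_cons (inr y) IHw) _.
  rewrite map_cat catA -cat_cons; apply: congr_cat; last exact: congr_refl.
  exact: (crossing_congr [:: y]).
Qed.

(** * Compatibility of the crossing with [R] and [T] *)

Section Compatibility.
Variables (R : wrel X) (T : wrel Y).

Hypothesis powR : forall u v, R (u, v) -> forall y,
  (R (rdot [:: y] u, rdot [:: y] v) \/ R (rdot [:: y] v, rdot [:: y] u)) /\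
  congr_gen T (rpow [:: y] u) (rpow [:: y] v).

Hypothesis dotT : forall a b, T (a, b) -> forall x,
  foldr dot x a = foldr dot x b /\ congr_gen T (lpow a x) (lpow b x).

(** Induction on the derivation, for all [x] at once: in a concatenation the left factors meet the
    letter that leaves the right ones, and it is the same letter on both sides. *)
Lemma letter_congrl a b x : congr_gen T a b ->
  foldr dot x a = foldr dot x b /\ congr_gen T (lpow a x) (lpow b x).
Proof.
move=> ab; elim: ab x => {a b}.
- by move=> a b Tab x; exact: dotT.
- by move=> a x; split=> //; exact: congr_refl.
- by move=> a b _ IH x; case: (IH x) => -> /congr_sym.
- move=> a b c _ IHab _ IHbc x; have [-> ab] := IHab x; have [-> bc] := IHbc x.
  by split=> //; exact: congr_trans ab bc.
- move=> a a' b b' _ IHa _ IHb x; rewrite !foldr_cat !lpow_cat.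
  have [-> bb'] := IHb x; have [-> aa'] := IHa (foldr dot x b').
  by split=> //; exact: congr_cat.
Qed.

Lemma rdot_rpow_congrl a b u : congr_gen T a b ->
  rdot a u = rdot b u /\ congr_gen T (rpow a u) (rpow b u).
Proof.
elim: u a b => [|x u IHu] a b ab //=.
by have [-> xab] := letter_congrl x ab; have [-> uab] := IHu _ _ xab.
Qed.

(** The induction must preserve membership in [R], up to order, because the hypothesis on letters
    speaks of pairs of [R] and is applied again at each letter of [a]. *)
Lemma rdot_rpow_rule a u v : R (u, v) ->
  (R (rdot a u, rdot a v) \/ R (rdot a v, rdot a u)) /\
  congr_gen T (rpow a u) (rpow a v).
Proof.
elim: a u v => [|y a IHa] u v Ruv.
  by rewrite !rdot_nil !rpow_nil; split; [left | exact: congr_refl].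
have [Ra Ta] := IHa u v Ruv.
rewrite -cat1s !rdot_catl !rpow_catl.
(* If the inner pair is reversed, the hypothesis is applied to the reversed pair and its outcome
   turned back. *)
case: Ra => /powR /(_ y) [Ry Ty]; split.
- by [].
- exact: congr_cat.
- by case: Ry => ?; [right | left].
- by apply: congr_cat => //; exact: congr_sym.
Qed.

Lemma rdot_rpow_congrr a u v : congr_gen R u v ->
  congr_gen R (rdot a u) (rdot a v) /\ congr_gen T (rpow a u) (rpow a v).
Proof.
move=> uv; elim: uv a => {u v}.
- move=> u v Ruv a; have [Ra Ta] := rdot_rpow_rule a Ruv; split=> //.
  by case: Ra => Ra; [|apply: congr_sym]; exact: congr_rule.
- by move=> u a; split; exact: congr_refl.
- by move=> u v _ IH a; case: (IH a) => ? ?; split; exact: congr_sym.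
- move=> u v w _ IHuv _ IHvw a.
  have [uv auv] := IHuv a; have [vw avw] := IHvw a.
  by split; [exact: congr_trans uv vw | exact: congr_trans auv avw].
- move=> u u' v v' _ IHu _ IHv a; rewrite !rdot_catr !rpow_catr.
  have [uu' auu'] := IHu a; have [-> bv] := rdot_rpow_congrl v auu'.
  have [vv' avv'] := IHv (rpow a u').
  by split; [exact: congr_cat | exact: congr_trans bv avv'].
Qed.

Lemma rdot_rpow_congr a b u v : congr_gen T a b -> congr_gen R u v ->
  congr_gen R (rdot a u) (rdot b v) /\ congr_gen T (rpow a u) (rpow b v).
Proof.
move=> ab uv; have [-> Tu] := rdot_rpow_congrl u ab.
have [Rv Tv] := rdot_rpow_congrr b uv.
by split=> //; exact: congr_trans Tu Tv.
Qed.

End Compatibility.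

(** * The functions on [A] and [U], and the presented product *)

Section Induced.
Variables (U A : monoidType) (R : wrel X) (T : wrel Y) (i : X -> U) (j : Y -> A).
Variables (act : A -> U -> U) (expo : A -> U -> A).
Hypothesis presU : presents R i.
Hypothesis presA : presents T j.
Hypothesis actE :
  forall a u, act (weval j a) (weval i u) = weval i (rdot a u).
Hypothesis expoE :
  forall a u, expo (weval j a) (weval i u) = weval j (rpow a u).

(** Every element is the value of a word, so each law is the image of its counterpart for words. *)
Lemma induced_zappa_szep : zappa_szep act expo.
Proof.
have [/choice[s sK] _] := (presentsP R i).1 presU.
have [/choice[t tK] _] := (presentsP T j).1 presA.
split=> [a b u|a b u|a u v|a u v|a|u|a|u].
- by rewrite -(tK a) -(tK b) -(sK u) -weval_cat !actE rdot_catl.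
- by rewrite -(tK a) -(tK b) -(sK u) -weval_cat !(actE, expoE) -weval_cat
    rpow_catl.
- by rewrite -(tK a) -(sK u) -(sK v) -weval_cat !(actE, expoE) -weval_cat
    rdot_catr.
- by rewrite -(tK a) -(sK u) -(sK v) -weval_cat !expoE rpow_catr.
- by rewrite -(tK a) -(weval_nil i) expoE.
- by rewrite -(sK u) -(weval_nil j) actE rdot_nil.
- by rewrite -(tK a) -(weval_nil i) actE.
- by rewrite -(sK u) -(weval_nil j) expoE rpow_nil.
Qed.

Lemma zs_product_presents (zs : zappa_szep act expo) :
  presents (map_wrel inl R `|` map_wrel inr T `|` W) (zs_gen zs i j).
Proof.
have [surjU eqU] := (presentsP R i).1 presU.
have [surjA eqA] := (presentsP T j).1 presA.
apply/presentsP; split=> [[u a]|w w'].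
  have [p <-] := surjU u; have [q <-] := surjA a.
  by exists (map inl p ++ map inr q); rewrite weval_zs_gen.
set P := _ `|` _.
have gP u v : P (u, v) -> weval (zs_gen zs i j) u = weval (zs_gen zs i j) v.
  case=> [[] [[p q] /= pq [<- <-]]|[y [x [-> ->]]]].
  - by rewrite !weval_zs_genl (eqU p q).1 //; exact: congr_rule.
  - by rewrite !weval_zs_genr (eqA p q).1 //; exact: congr_rule.
  - rewrite weval_zs_gen_swap (weval_zs_gen _ i j [:: dot y x]).
    rewrite -(weval1 i x) -(weval1 j y) actE expoE /=.
    by rewrite cats0.
split=> [|ww']; first exact: weval_congr.
have WP : W `<=` P by move=> ? ?; right.
have [p [q /(congr_gen_sub WP) wpq]] := congr_gen_normal_form w.
have [p' [q' /(congr_gen_sub WP) wpq']] := congr_gen_normal_form w'.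
apply: (congr_trans wpq (congr_trans _ (congr_sym wpq'))).
(* Normal forms evaluate to pairs, so equal values split into an equality in [U] and one in [A],
   that is, congruences under [R] and [T]. *)
have [/eqU pp' /eqA qq'] : weval i p = weval i p' /\ weval j q = weval j q'.
  move: ww'; rewrite (weval_congr gP wpq) (weval_congr gP wpq').
  by rewrite !weval_zs_gen => -[].
by apply: congr_cat; [apply: congr_gen_map pp' | apply: congr_gen_map qq'];
  move=> u v uv; apply: congr_rule; left; [left | right]; exists (u, v).
Qed.

End Induced.

End CrossingWords.

Theorem lemma3p19
  (X Y : choiceType) (U A : monoidType)
  (R : wrel X) (T : wrel Y) (i : X -> U) (j : Y -> A)
  (presU : presents R i) (presA : presents T j)
  (dot : Y -> X -> X) (pow : Y -> X -> seq Y)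
  (hR : forall u v : seq X, R (u, v) -> forall a : Y,
     (R (wdot dot pow [:: a] u, wdot dot pow [:: a] v) \/
      R (wdot dot pow [:: a] v, wdot dot pow [:: a] u)) /\
     congr_gen T (wpow dot pow [:: a] u) (wpow dot pow [:: a] v))
  (hT : forall a b : seq Y, T (a, b) -> forall u : X,
     wdot dot pow a [:: u] = wdot dot pow b [:: u] /\
     congr_gen T (wpow dot pow a [:: u]) (wpow dot pow b [:: u])) :
  exists (act : A -> U -> U) (expo : A -> U -> A),
    (* the extensions induce act and expo *)
    (forall (a : seq Y) (u : seq X),
       act (weval j a) (weval i u) = weval i (wdot dot pow a u)) /\
    (forall (a : seq Y) (u : seq X),
       expo (weval j a) (weval i u) = weval j (wpow dot pow a u)) /\
    exists zs : zappa_szep act expo,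
      (forall (a : Y) (u : X), exists x : X, act (j a) (i u) = i x) /\
      (* expo maps the generators to the prescribed words of Y^*, hence to Y
         when the given function does *)
      (forall (a : Y) (u : X), expo (j a) (i u) = weval j (pow a u)) /\
      ((forall (a : Y) (u : X), exists b : Y, pow a u = [:: b]) ->
       forall (a : Y) (u : X), exists b : Y, expo (j a) (i u) = j b) /\
      presents (map_wrel inl R `|` map_wrel inr T `|` crossing_rules dot pow)
        (zs_gen zs i j) /\
      (forall (a : A) (u : X), exists x : X, act a (i u) = i x).
Proof.
have [surjU eqU] := (presentsP R i).1 presU.
have [surjA eqA] := (presentsP T j).1 presA.
have powR u v : R (u, v) -> forall y,
    (R (rdot dot pow [:: y] u, rdot dot pow [:: y] v) \/
     R (rdot dot pow [:: y] v, rdot dot pow [:: y] u)) /\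
    congr_gen T (rpow dot pow [:: y] u) (rpow dot pow [:: y] v).
  by move=> Ruv y; rewrite -!wdotE -!wpowE; exact: hR.
have dotT a b : T (a, b) -> forall x, foldr dot x a = foldr dot x b /\
    congr_gen T (lpow dot pow a x) (lpow dot pow b x).
  by move=> /hT Tab x; have := Tab x; rewrite !wdotE !wpowE => -[[]].
have [s sK] := choice surjU; have [t tK] := choice surjA.
(* Both functions are computed on chosen words; compatibility with [R] and [T] makes the choice
   immaterial. *)
pose act a u := weval i (rdot dot pow (t a) (s u)).
pose expo a u := weval j (rpow dot pow (t a) (s u)).
have tT a : congr_gen T (t (weval j a)) a by apply/eqA; rewrite tK.
have sR u : congr_gen R (s (weval i u)) u by apply/eqU; rewrite sK.
have actE a u : act (weval j a) (weval i u) = weval i (rdot dot pow a u).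
  by apply/eqU; case: (rdot_rpow_congr powR dotT (tT a) (sR u)).
have expoE a u : expo (weval j a) (weval i u) = weval j (rpow dot pow a u).
  by apply/eqA; case: (rdot_rpow_congr powR dotT (tT a) (sR u)).
(* A letter of [X] crossing any word remains a letter; both claims about images in [X] follow. *)
have act_letter a u : act (weval j a) (i u) = i (foldr dot u a).
  by rewrite -(weval1 i u) actE weval1.
have expo_letter a u : expo (j a) (i u) = weval j (pow a u).
  by rewrite -(weval1 i u) -(weval1 j a) expoE /= cats0.
exists act, expo; split; first by move=> a u; rewrite wdotE.
split; first by move=> a u; rewrite wpowE.
exists (induced_zappa_szep presU presA actE expoE).
split; first by move=> a u; exists (dot a u); rewrite -(weval1 j a) act_letter.
split=> //; split.
  by move=> pow1 a u; have [b ab] := pow1 a u; exists b;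
    rewrite expo_letter ab weval1.
split; first exact: zs_product_presents.
by move=> a u; exists (foldr dot u (t a)); rewrite -{1}(tK a) act_letter.
Qed.
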